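(* Let $d\ge 1$, $\sigma\ge 2$, $\mathcal I=\mathbb R_{>0}$, and let $f:\mathbb R^d\to\mathbb R$ be smooth. Zhang's equation $$\ddot x+\frac{2\sigma+1}{t}\,\dot x+\sigma^2t^{\sigma-2}\,\nabla f(x)=0,\qquad x\in\mathbb R^d,\ t\in\mathcal I,$$ is expressed as a non-autonomous contact Hamiltonian system. That is, there is a smooth function $K$ on $\mathbb R^{2d+1}\times\mathcal I$, with coordinates $(q^0,q^1,\dots,q^d,\gamma_1,\dots,\gamma_d,t)$, such that the curves $x(t)$ solving Zhang's equation are exactly the components $(q^1(t),\dots,q^d(t))$ of solutions of the contact Hamiltonian equations of motion of $K$.
   Context: A dot denotes $d/dt$. The contact Hamiltonian equations of motion of a (non-autonomous) contact Hamiltonian $K$ on $\mathbb R^{2d+1}\times\mathcal I$ are, for $a=1,\dots,d$, $$\dot q^a=\frac{\partial K}{\partial\gamma_a},\qquad \dot\gamma_a=-\frac{\partial K}{\partial q^a}-\gamma_a\frac{\partial K}{\partial q^0},\qquad \dot q^0=-K+\sum_{b=1}^d\gamma_b\frac{\partial K}{\partial\gamma_b},\qquad \dot t=1.$$ *)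

(* Defs.v *)
From HB Require Import structures.
From mathcomp Require Import all_boot all_order all_algebra.
From mathcomp Require Import all_classical all_reals all_analysis.
Import Order.TTheory GRing.Theory Num.Theory.
Import numFieldNormedType.Exports.

Set Implicit Arguments.
Unset Strict Implicit.
Unset Printing Implicit Defensive.

Local Open Scope ring_scope.
Local Open Scope classical_set_scope.

(* Meant for finite-dimensional V and open U: there, asking every directional
   derivative of a Frechet-differentiable g to be of class C^k amounts to asking
   the Frechet derivative of g to be of class C^k. *)
Fixpoint Ck (R : realType) (V : normedModType R) (k : nat) (U : set V)
    (g : V -> R) : Prop :=
  match k with
  | 0 => forall p, U p -> {for p, continuous g}
  | k'.+1 => (forall p, U p -> differentiable g p) /\
             (forall v : V, Ck k' U ('D_v g))
  end.

Definition smooth_on (R : realType) (V : normedModType R) (U : set V)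
    (g : V -> R) : Prop :=
  forall k : nat, Ck k U g.

Definition gradient (R : realType) (d : nat) (f : 'rV[R]_d -> R)
    (x : 'rV[R]_d) : 'rV[R]_d :=
  \row_(a < d) 'D_(delta_mx 0 a) f x.

Definition zhang_solution (R : realType) (d : nat) (sigma : R)
    (f : 'rV[R]_d -> R) (J : set R) (x : R -> 'rV[R]_d) : Prop :=
  forall t : R, J t ->
    [/\ derivable x t 1, derivable (derive1 x) t 1 &
        derive1 (derive1 x) t + ((2 * sigma + 1) / t) *: derive1 x t
        + (sigma ^+ 2 * t `^ (sigma - 2)) *: gradient f (x t) = 0].

(* A point (q0, q, gamma, t) of R^(2d+1) x R, with q = (q^1, ..., q^d) and
   gamma = (gamma_1, ..., gamma_d). *)
Notation extended_phase R d := (R * 'rV[R]_d * 'rV[R]_d * R)%type.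

Definition positive_time (R : realType) (d : nat) : set (extended_phase R d) :=
  [set p | 0 < p.2].
Arguments positive_time : clear implicits.

Definition partial_q0 (R : realType) (d : nat) (K : extended_phase R d -> R) :
    extended_phase R d -> R :=
  'D_((1, 0, 0, 0) : extended_phase R d) K.

Definition partial_q (R : realType) (d : nat) (a : 'I_d)
    (K : extended_phase R d -> R) : extended_phase R d -> R :=
  'D_((0, delta_mx 0 a, 0, 0) : extended_phase R d) K.

Definition partial_gamma (R : realType) (d : nat) (a : 'I_d)
    (K : extended_phase R d -> R) : extended_phase R d -> R :=
  'D_((0, 0, delta_mx 0 a, 0) : extended_phase R d) K.

(* Curves are parametrised by the time coordinate t itself (the dot is d/dt),
   so the equation dt/dt = 1 holds by construction. *)
Definition contact_solution (R : realType) (d : nat)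
    (K : extended_phase R d -> R) (J : set R) (q0 : R -> R)
    (q gamma : R -> 'rV[R]_d) : Prop :=
  forall t : R, J t ->
    let p : extended_phase R d := (q0 t, q t, gamma t, t) in
    [/\ forall a : 'I_d,
          is_derive t 1 (fun s => q s 0 a) (partial_gamma a K p),
        forall a : 'I_d,
          is_derive t 1 (fun s => gamma s 0 a)
            (- partial_q a K p - gamma t 0 a * partial_q0 K p) &
        is_derive t 1 q0
          (- K p + \sum_(b < d) gamma t 0 b * partial_gamma b K p)].

(* Main.v *)
(* With K = |gamma|^2/2 + sigma^2 t^(sigma-2) f(q) + ((2 sigma + 1)/t) q0 the
   contact equations read q' = gamma,
   gamma' = - sigma^2 t^(sigma-2) grad f(q) - ((2 sigma + 1)/t) gamma, which is
   Zhang's equation written as a first-order system, together with a decoupled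
   linear equation for the action,
   q0' + ((2 sigma + 1)/t) q0 = |gamma|^2/2 - sigma^2 t^(sigma-2) f(q).
   The latter has a solution on all of J along any given curve, by the
   integrating factor t^(2 sigma + 1). *)
From HB Require Import structures.
Require Import Defs.
From mathcomp Require Import all_boot all_order all_algebra.
From mathcomp Require Import all_classical all_reals all_analysis.
From mathcomp Require Import ring lra.
Import Order.TTheory GRing.Theory Num.Theory.
Import numFieldNormedType.Exports.

Local Open Scope ring_scope.
Local Open Scope classical_set_scope.

(** The expansion g(x + h) = g(x) + 'd f x h + o(h) holds because f and g agree at x and at x + h
    for small h; uniqueness of the differential then identifies 'd g x with 'd f x. *)
Lemma near_eq_differentiable (R : numFieldType) (V W : normedModType R)
    (f g : V -> W) (x : V) :
  (\near x, f x = g x) -> differentiable f x -> differentiable g x.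
Proof.
move=> fg df; have [dfc dfE] := (diff_locallyP _ _).1 df.
have dgE : g \o shift x = cst (g x) + 'd f x +o_ 0 id.
  apply/eqaddoP => e e0.
  move/eqaddoP : dfE => /(_ e e0) dfE.
  rewrite -(nbhs_singleton fg).
  have fg0 : \forall h \near (0 : V), f (h + x) = g (h + x).
    by move: fg; rewrite (near_shift 0 x) /=; apply: filterS => h /=; rewrite subr0.
  near=> h.
  have -> : (g \o shift x - (cst (f x) + 'd f x)) h
     = (f \o shift x - (cst (f x) + 'd f x)) h.
    by rewrite /= !fctE /= -(near fg0 h).
  by near: h.
by apply/diff_locallyP; rewrite (diff_unique dfc dgE).
Unshelve. all: by end_near. Qed.

(** * Antiderivatives of continuous functions on an open interval *)

Section Antiderivative.
Context {R : realType}.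
Local Notation mu := (@lebesgue_measure R).

(** Provides a left endpoint in [J] from which integrals up to a neighbourhood of [s] and of [t] can
    both be taken. *)
Lemma open_interval_around (J : set R) (s t : R) : open J -> J s -> J t ->
  exists a b, [/\ J a, J b, a < s < b & a < t < b].
Proof.
move=> oJ.
have nb u : J u -> exists a b, [/\ J a, J b, a < u & u < b].
  move=> Ju; have /nbhs_ballP[e /= e0 eJ] : nbhs u J by exact: open_nbhs_nbhs.
  exists (u - e / 2), (u + e / 2); split; last 2 first.
  - by rewrite ltrBlDr ltrDl divr_gt0.
  - by rewrite ltrDl divr_gt0.
  - by apply: eJ; rewrite /ball/= opprB addrC subrK gtr0_norm ?divr_gt0//; lra.
  - by apply: eJ; rewrite /ball/= opprD addrA subrr sub0r normrN
      gtr0_norm ?divr_gt0//; lra.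
move=> /nb[a1 [b1 [Ja1 Jb1 a1s sb1]]] /nb[a2 [b2 [Ja2 Jb2 a2t tb2]]].
exists (Num.min a1 a2), (Num.max b1 b2); split.
- by rewrite minEle; case: ifP.
- by rewrite maxEle; case: ifP.
- by rewrite gt_min a1s lt_max sb1.
- by rewrite gt_min a2t lt_max tb2 !orbT.
Qed.

(** The antiderivative is the integral from a base point [c] of [J]. Near a given [t] it differs by
    a constant from the integral starting at some [a] of [J] to the left of both [c] and [t], and
    the fundamental theorem of calculus applies to the latter. *)
Lemma continuous_antiderivative (J : set R) (g : R -> R) :
  open J -> is_interval J -> (forall t, J t -> {for t, continuous g}) ->
  exists G : R -> R, forall t, J t -> is_derive t 1 G (g t).
Proof.
move=> oJ iJ cg.
have [-> | /set0P[c Jc]] := eqVneq J set0; first by exists (cst 0).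
(* An empty interval `[c, t] contributes 0, so this is the oriented integral. *)
exists (fun t => \int[mu]_(s in `[c, t]) g s - \int[mu]_(s in `[t, c]) g s).
move=> t Jt.
have [a [b [Ja Jb /andP[ac cb] /andP[at_ tb]]]] :=
  open_interval_around J c t oJ Jc Jt.
have ig : mu.-integrable `[a, b] (EFin \o g).
  apply: continuous_compact_integrable; first exact: segment_compact.
  apply: continuous_in_subspaceT => s; rewrite inE/= in_itv/= => sab.
  by apply: cg; exact: iJ sab.
have igr r : r <= b -> mu.-integrable `[a, r] (EFin \o g).
  by move=> rb; apply: integrableS ig => //; apply: subset_itvl; rewrite bnd_simp.
have igl q r : a <= q -> r <= b -> mu.-integrable `]q, r] (EFin \o g).
  move=> aq rb; apply: integrableS ig => //; apply: subset_itv;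
  by rewrite bnd_simp.
have intB q r : a <= q -> q <= r -> r <= b ->
    \int[mu]_(s in `[a, r]) g s - \int[mu]_(s in `[a, q]) g s =
    \int[mu]_(s in `[q, r]) g s.
  (* Cutting [[a, r]] at [q] leaves the half-open []q, r]], which has the same integral as the
     closed segment. *)
  move=> aq qr rb; rewrite Rintegral_itvB ?bnd_simp//; last exact: igr.
  by rewrite Rintegral_itv_obnd_cbnd//; exact: igl.
(* The segment is empty or a point here, so on either side of [c] one of the two integrals in the
   antiderivative vanishes. *)
have int0 q r : r <= q -> \int[mu]_(s in `[q, r]) g s = 0.
  rewrite le_eqVlt => /predU1P[->|rq]; first by rewrite set_itv1 Rintegral_set1.
  by rewrite set_itv_ge ?Rintegral_set0// bnd_simp -ltNge.
apply: (@near_eq_is_derive _ _ _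
  (fun r => \int[mu]_(s in `[a, r]) g s - \int[mu]_(s in `[a, c]) g s)).
  near=> r.
  have ar : a < r by near: r; exact: lt_nbhsr.
  have rb : r < b by near: r; exact: lt_nbhsl.
  have [cr|/ltW rc] := leP c r.
    by rewrite intB ?(ltW ac) ?(ltW rb)// (int0 _ _ cr) subr0.
  rewrite (int0 _ _ rc) sub0r -opprB intB//; exact: ltW.
have [dF dFE] := @continuous_FTC1_closed R g a t b tb ig at_ (cg _ Jt).
have dFt : is_derive t 1 (fun r => \int[mu]_(s in `[a, r]) g s) (g t).
  by apply: DeriveDef; [exact: dF|rewrite -derive1E; exact: dFE].
have := is_deriveB dFt (is_derive_cst (\int[mu]_(s in `[a, c]) g s) t 1).
by rewrite subr0.
Unshelve. all: by end_near. Qed.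

End Antiderivative.

(** * Closure properties of the classes C^k on open sets *)

Section Ck_theory.
Context {R : realType}.
Implicit Types (V W : normedModType R) (k : nat).

(** On an open set, equality on [U] is equality near each point of [U], so it passes to directional
    derivatives and the induction goes through. This allows derivative formulas valid only on [U] to
    be used below. *)
Lemma Ck_eq V k (U : set V) (g h : V -> R) : open U ->
  (forall p, U p -> g p = h p) -> Ck k U g -> Ck k U h.
Proof.
move=> oU; elim: k g h => [|k IHk] g h gh /=.
  move=> cg p Up; have ngh : \forall q \near p, g q = h q.
    by apply: filterS (open_nbhs_nbhs (conj oU Up)).
  rewrite /prop_for /continuous_at -(gh _ Up); apply: cvg_trans (cg p Up).
  exact: near_eq_cvg.
have ngh p : U p -> \forall q \near p, g q = h q.
  by move=> Up; apply: filterS (open_nbhs_nbhs (conj oU Up)).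
move=> [dg Ckg]; split=> [p Up|v].
  exact: near_eq_differentiable (ngh p Up) (dg p Up).
apply: IHk (Ckg v) => p Up.
exact: near_eq_derive (ngh p Up).
Qed.

Lemma CkW V k (U : set V) (g : V -> R) : Ck k.+1 U g -> Ck k U g.
Proof.
elim: k g => [|k IHk] g [dg Ckg].
  by move=> p Up; apply: differentiable_continuous; exact: dg.
by split=> // v; apply: IHk.
Qed.

Lemma Ck_cst V k (U : set V) (c : R) : Ck k U (cst c : V -> R).
Proof.
elim: k c => [|k IHk] c /=; first by move=> p _; exact: cst_continuous.
split=> // v; rewrite (_ : 'D_v _ = cst 0) //.
by apply/funext => p; rewrite derive_cst.
Qed.

Lemma CkD V k (U : set V) (f g : V -> R) : open U ->
  Ck k U f -> Ck k U g -> Ck k U (f + g).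
Proof.
move=> oU; elim: k f g => [|k IHk] f g.
  by move=> cf cg p Up; apply: continuousD; [exact: cf|exact: cg].
move=> [df Ckf] [dg Ckg]; split=> [p Up|v].
  by apply: differentiableD; [exact: df|exact: dg].
apply: Ck_eq (IHk _ _ (Ckf v) (Ckg v)) => // p Up.
by rewrite deriveD//; apply: diff_derivable; [exact: df|exact: dg].
Qed.

Lemma CkM V k (U : set V) (f g : V -> R) : open U ->
  Ck k U f -> Ck k U g -> Ck k U (f * g).
Proof.
move=> oU; elim: k f g => [|k IHk] f g.
  by move=> cf cg p Up; apply: continuousM; [exact: cf|exact: cg].
move=> Cf Cg; have [df Ckf] := Cf; have [dg Ckg] := Cg; split=> [p Up|v].
  by apply: differentiableM; [exact: df|exact: dg].
(* In the Leibniz rule each product has one undifferentiated factor, which [CkW] lowers from class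
   C^(k+1) to C^k. *)
apply: (Ck_eq _ _ _ _ _ oU _ (CkD _ _ _ _ _ oU (IHk _ _ (CkW _ _ _ _ Cf) (Ckg v))
  (IHk _ _ (CkW _ _ _ _ Cg) (Ckf v)))) => // p Up.
by rewrite deriveM//; apply: diff_derivable; [exact: df|exact: dg].
Qed.

Lemma Ck_sum V k (U : set V) n (f : 'I_n -> V -> R) : open U ->
  (forall i, Ck k U (f i)) -> Ck k U (\sum_(i < n) f i).
Proof.
move=> oU Cf; elim/big_ind : _ => //; first exact: Ck_cst.
by move=> g h; exact: CkD.
Qed.

Lemma is_derive_comp_linear {V W} (L : {linear V -> W}) (g : W -> R) p v :
  continuous L -> differentiable g (L p) ->
  is_derive p v (g \o L) ('D_(L v) g (L p)).
Proof.
move=> cL dg; have dL := linear_differentiable p cL.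
have dgL : differentiable (g \o L) p by exact: differentiable_comp.
split; first exact: diff_derivable.
by rewrite !deriveE// diff_comp//= (diff_lin _ cL).
Qed.

(** Since 'D_v (g \o L) = ('D_(L v) g) \o L, differentiation keeps the form of a composite with [L],
    and induction on [k] applies. It lifts functions of time, position or momentum to the extended
    phase space. *)
Lemma Ck_comp_linear {V W} k (L : {linear V -> W}) (U : set V) (U' : set W)
    (g : W -> R) : open U -> continuous L -> (forall p, U p -> U' (L p)) ->
  Ck k U' g -> Ck k U (g \o L).
Proof.
move=> oU cL UU'; elim: k g => [|k IHk] g.
  by move=> cg p Up; apply: continuous_comp; [exact: cL|exact: cg (UU' _ Up)].
move=> [dg Ckg]; split=> [p Up|v].
  apply: differentiable_comp; last exact: dg (UU' _ Up).
  exact: linear_differentiable.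
apply: Ck_eq (IHk _ (Ckg (L v))) => // p Up.
have dgL := is_derive_comp_linear L g p v cL (dg _ (UU' _ Up)).
by rewrite (@derive_val _ _ _ _ _ _ _ dgL).
Qed.

Lemma smooth_linear V (U : set V) (L : {linear V -> R}) : continuous L ->
  smooth_on U L.
Proof.
move=> cL [|k] /=; first by move=> p _; exact: cL.
split=> [p _|v]; first exact: linear_differentiable.
rewrite (_ : 'D_v _ = cst (L v)); first exact: Ck_cst.
apply/funext => p; rewrite deriveE ?(diff_lin _ cL)//.
exact: linear_differentiable.
Qed.

(** The derivative of a power is a constant times another power, so the induction on [k] runs over
    all exponents at once. *)
Lemma smooth_powR (c : R) : smooth_on [set t : R | 0 < t] (fun t : R => t `^ c).
Proof.
have oU : open [set t : R | 0 < t] by exact: open_gt.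
have dp a (t : R) : 0 < t -> differentiable (fun s : R => s `^ a) t.
  by move=> t0; apply/derivable1_diffP; apply: ex_derive; exact: is_derive1_powR.
move=> k; elim: k c => [|k IHk] c /=.
  by move=> t t0; apply: differentiable_continuous; exact: dp.
split=> [t t0|v]; first exact: dp.
apply: (Ck_eq _ _ _ _ _ oU _
  (CkM _ _ _ _ _ oU (Ck_cst _ _ _ (v * c)) (IHk (c - 1)))) => t t0.
rewrite deriveE; last exact: dp.
(* The derivative of the power is known in direction 1; linearity of the differential gives
   direction [v]. *)
rewrite (_ : v = v *: 1); last by rewrite [_ *: _]mulr1.
rewrite linearZ/= -deriveE; last exact: dp.
have dpt := @is_derive1_powR R c t t0.
rewrite (@derive_val _ _ _ _ _ _ _ dpt) [v%:A]mulr1.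
by rewrite [RHS]mulrA.
Qed.

(** Equips the entry maps with a linear structure, so that the results on continuous linear maps
    apply to them. *)
Lemma coord_linear_form m n (i : 'I_m) (j : 'I_n) :
  exists2 L : {linear 'M[R]_(m, n) -> R}, continuous L &
    (fun M : 'M[R]_(m, n) => M i j) = L.
Proof.
have lin : linear (fun M : 'M[R]_(m, n) => M i j : R).
  by move=> c A B; rewrite !mxE.
pose Llin := GRing.isLinear.Build R 'M[R]_(m, n) R _ _ lin.
exists (HB.pack (fun M : 'M[R]_(m, n) => M i j : R) Llin : {linear _ -> _}) => //.
exact: coord_continuous.
Qed.

(** Links the contact equations, stated coordinate by coordinate, with the vector form of Zhang's
    equation. *)
Lemma is_derive_mxP m n (M : R -> 'M[R]_(m, n)) (t : R) (D : 'M[R]_(m, n)) :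
  is_derive t 1 M D <-> forall i j, is_derive t 1 (fun s => M s i j) (D i j).
Proof.
split=> [[dM <-] i j|dM].
  split; first exact: (derivable_mxP _ _ _).1 dM i j.
  by rewrite derive_mx// mxE.
have dMt : derivable M t 1.
  by apply/derivable_mxP => i j; apply: ex_derive; exact: dM.
split => //; apply/matrixP => i j; rewrite derive_mx// mxE.
have dMij := dM i j.
by rewrite (@derive_val _ _ _ _ _ _ _ dMij).
Qed.

End Ck_theory.

(** * The Hamiltonian: smoothness and directional derivatives *)

Section Zhang_hamiltonian.
Context {R : realType} {d : nat}.
Variables (sigma : R) (f : 'rV[R]_d -> R).

(* (2 sigma + 1) / t is written with t `^ (-1), which agrees with t^-1
   only for t >= 0, so that a single smoothness lemma covers every power of t. *)
Definition zhang_hamiltonian (p : extended_phase R d) : R :=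
  2^-1 * (\sum_(a < d) p.1.2 0 a * p.1.2 0 a)
  + (sigma ^+ 2 * p.2 `^ (sigma - 2)) * f p.1.1.2
  + ((2 * sigma + 1) * p.2 `^ (-1)) * p.1.1.1.

Let time : {linear extended_phase R d -> R} := snd.
Let action : {linear extended_phase R d -> R} := fst \o (fst \o fst).
Let position : {linear extended_phase R d -> 'rV[R]_d} := snd \o (fst \o fst).
Let momentum : {linear extended_phase R d -> 'rV[R]_d} := snd \o fst.

Let time_continuous : continuous time.
Proof. by move=> p; exact: cvg_snd. Qed.

Let action_continuous : continuous action.
Proof.
by move=> p; apply: continuous_comp; [apply: continuous_comp|]; exact: cvg_fst.
Qed.

Let position_continuous : continuous position.
Proof.
move=> p; apply: continuous_comp; last exact: cvg_snd.
by apply: continuous_comp; exact: cvg_fst.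
Qed.

Let momentum_continuous : continuous momentum.
Proof. by move=> p; apply: continuous_comp; [exact: cvg_fst|exact: cvg_snd]. Qed.

(** Writes the Hamiltonian through sums and products of functions that factor through linear
    projections, the form in which the closure and derivation rules apply. *)
Let zhang_hamiltonianE : zhang_hamiltonian =
  cst (2^-1) * (\sum_(a < d) ((fun M : 'rV[R]_d => M 0 a) \o momentum)
    * ((fun M : 'rV[R]_d => M 0 a) \o momentum))
  + (cst (sigma ^+ 2) * ((fun t => t `^ (sigma - 2)) \o time)) * (f \o position)
  + (cst (2 * sigma + 1) * ((fun t => t `^ (-1)) \o time)) * action.
Proof. by apply/funext => p; rewrite /zhang_hamiltonian !fctE fct_sumE. Qed.

Lemma open_positive_time : open (positive_time R d).
Proof.
apply: (@open_comp _ _ time [set t : R | 0 < t]); last exact: open_gt.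
by move=> p _; exact: time_continuous.
Qed.

Lemma smooth_zhang_hamiltonian : smooth_on setT f ->
  smooth_on (positive_time R d) zhang_hamiltonian.
Proof.
move=> sf k; rewrite zhang_hamiltonianE.
have oT := open_positive_time.
have Cpow c : Ck k (positive_time R d) ((fun t => t `^ c) \o time).
  by apply: (Ck_comp_linear _ _ _ _ _ oT time_continuous _ (smooth_powR c k)).
apply: CkD => //; last first.
  apply: CkM => //; last exact: smooth_linear.
  by apply: CkM => //; exact: Ck_cst.
apply: CkD => //.
  apply: CkM => //; first exact: Ck_cst.
  have Ccoord a : Ck k (positive_time R d)
      ((fun M : 'rV[R]_d => M 0 a) \o momentum).
    have [L cL ->] := @coord_linear_form R 1 d 0 a.
    have CL : Ck k setT L by exact: smooth_linear.
    by apply: (Ck_comp_linear k momentum _ _ _ oT momentum_continuous _ CL).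
  by apply: Ck_sum => // a; exact: CkM.
apply: CkM => //; first by apply: CkM => //; exact: Ck_cst.
by apply: (Ck_comp_linear k position _ _ _ oT position_continuous _ (sf k)).
Qed.

(** The partial derivatives in the contact equations are all along directions with zero time
    component, where the powers of t count as constants. *)
Lemma is_derive_zhang_hamiltonian (p v : extended_phase R d) :
  differentiable f p.1.1.2 -> 0 < p.2 -> v.2 = 0 ->
  is_derive p v zhang_hamiltonian
    (\sum_(a < d) p.1.2 0 a * v.1.2 0 a
    + sigma ^+ 2 * p.2 `^ (sigma - 2) * 'D_(v.1.1.2) f p.1.1.2
    + (2 * sigma + 1) / p.2 * v.1.1.1).
Proof.
move=> df t0 v0; rewrite zhang_hamiltonianE.
have dpow c : is_derive p v ((fun t => t `^ c) \o time) 0.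
  have dc : differentiable (fun t : R => t `^ c) (time p).
    by apply/derivable1_diffP; apply: ex_derive; exact: is_derive1_powR.
  have := is_derive_comp_linear time _ p v time_continuous dc.
  by rewrite [time v]v0 derive0.
have dlin (L : {linear extended_phase R d -> R}) : continuous L ->
    is_derive p v L (L v).
  move=> cL; have dL := linear_differentiable p cL.
  by split; [exact: diff_derivable|rewrite deriveE// (diff_lin _ cL)].
have dcoord a : is_derive p v ((fun M : 'rV[R]_d => M 0 a) \o momentum)
    (v.1.2 0 a).
  have [L cL LE] := @coord_linear_form R 1 d 0 a; rewrite LE.
  rewrite [X in is_derive _ _ _ X](_ : _ = (L \o momentum) v); last by rewrite -LE.
  apply: dlin => q.
  by apply: continuous_comp; [exact: momentum_continuous|exact: cL].
have dact := dlin action action_continuous.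
have dpos := is_derive_comp_linear position f p v position_continuous df.
have dcst (c : R) := is_derive_cst c p v.
have dkin := is_derive_sum (fun a => is_deriveM (dcoord a) (dcoord a)).
apply: (is_derive_eq
  (is_deriveD (is_deriveD (is_deriveM (dcst _) dkin)
    (is_deriveM (is_deriveM (dcst _) (dpow _)) dpos))
    (is_deriveM (is_deriveM (dcst _) (dpow _)) dact))).
rewrite !scaler0 !addr0 !scaler0 !addr0; congr (_ + _ + _).
- rewrite [LHS]mulr_sumr; apply: eq_bigr => a _.
  (* The Leibniz rule on a square gives the same term twice, which the factor 1/2 compensates. *)
  rewrite /cst/= -!/(_ * _) -mulr2n -[X in _ * X]mulr_natl mulrA.
  by rewrite mulVf ?mul1r ?pnatr_eq0.
- by rewrite -powR_inv1 ?ltW.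
Qed.

End Zhang_hamiltonian.

(** * Contact equations of the Hamiltonian and Zhang's equation *)

Lemma partial_zhang_hamiltonian (R : realType) (d : nat) (sigma : R)
    (f : 'rV[R]_d -> R) (p : extended_phase R d) :
  differentiable f p.1.1.2 -> 0 < p.2 ->
  [/\ forall a, partial_gamma a (zhang_hamiltonian sigma f) p = p.1.2 0 a,
      forall a, partial_q a (zhang_hamiltonian sigma f) p =
        sigma ^+ 2 * p.2 `^ (sigma - 2) * gradient f p.1.1.2 0 a &
      partial_q0 (zhang_hamiltonian sigma f) p = (2 * sigma + 1) / p.2].
Proof.
move=> df t0.
have DK (v : extended_phase R d) (v0 : v.2 = 0) :=
  @derive_val _ _ _ _ _ _ _ (is_derive_zhang_hamiltonian sigma f p v df t0 v0).
have sum0 : \sum_(a < d) p.1.2 0 a * (0 : 'rV[R]_d) 0 a = 0.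
  by rewrite big1// => a _; rewrite mxE mulr0.
split=> [a|a|].
- rewrite /partial_gamma DK//= derive0 !mulr0 !addr0.
  rewrite (bigD1 a)//= big1 => [|b ba]; first by rewrite mxE !eqxx mulr1 addr0.
  by rewrite mxE (negbTE ba) andbF mulr0.
- by rewrite /partial_q DK//= sum0 mulr0 addr0 add0r mxE.
- by rewrite /partial_q0 DK//= sum0 derive0 mulr0 !add0r mulr1.
Qed.

(** Multiplying y' + (c/t) y = g by t^c gives (t^c y)' = t^c g, so y = t^(-c) G works on all of [J]
    for any antiderivative G of t^c g. *)
Lemma linear_ode_solution (R : realType) (J : set R) (c : R) (g : R -> R) :
  open J -> is_interval J -> J `<=` [set t | 0 < t] ->
  (forall t, J t -> {for t, continuous g}) ->
  exists y : R -> R, forall t, J t -> is_derive t 1 y (g t - c / t * y t).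
Proof.
move=> oJ iJ J0 cg.
have dpow (a t : R) :
    0 < t -> is_derive t 1 (fun s : R => s `^ a) (a * t `^ (a - 1)).
  by move=> t0; exact: is_derive1_powR.
have cgc t : J t -> {for t, continuous ((fun s => s `^ c) * g)}.
  move=> Jt; apply: continuousM; last exact: cg.
  apply: differentiable_continuous; apply/derivable1_diffP.
  exact: (@ex_derive _ _ _ _ _ _ _ (dpow c t (J0 _ Jt))).
have [G dG] := continuous_antiderivative J _ oJ iJ cgc.
exists ((fun t => t `^ (- c)) * G) => t Jt.
have t0 : 0 < t := J0 _ Jt.
apply: (is_derive_eq (is_deriveM (dpow (- c) t t0) (dG t Jt))).
have tc : t `^ (- c) * t `^ c = 1.
  by rewrite -powRD ?addNr ?powRr0// (gt_eqF t0) implybT.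
have tc1 : t `^ (- c - 1) = t `^ (- c) / t.
  by rewrite powRB ?powRr1 ?(ltW t0)// (gt_eqF t0) implybT.
rewrite tc1.
change (t `^ (- c) * (t `^ c * g t) + G t * (- c * (t `^ (- c) / t)) =
  g t - c / t * (t `^ (- c) * G t)).
by rewrite mulrA tc; ring.
Qed.

(** Both systems have the same right-hand sides at each t of [J], by the formulas for the partial
    derivatives; this one comparison serves both directions. *)
Lemma contact_zhang_hamiltonianP (R : realType) (d : nat) (sigma : R)
    (f : 'rV[R]_d -> R) (J : set R) (q0 : R -> R) (q gamma : R -> 'rV[R]_d) :
  (forall y, differentiable f y) -> J `<=` [set t | 0 < t] ->
  contact_solution (zhang_hamiltonian sigma f) J q0 q gamma <->
  forall t, J t ->
    [/\ is_derive t 1 q (gamma t),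
        is_derive t 1 gamma (- ((sigma ^+ 2 * t `^ (sigma - 2)) *: gradient f (q t))
          - ((2 * sigma + 1) / t) *: gamma t) &
        is_derive t 1 q0
          ((2^-1 * (\sum_(a < d) gamma t 0 a * gamma t 0 a)
            - sigma ^+ 2 * t `^ (sigma - 2) * f (q t))
           - (2 * sigma + 1) / t * q0 t)].
Proof.
move=> df J0.
suff eqs t : J t -> let p : extended_phase R d := (q0 t, q t, gamma t, t) in
  [/\ forall a, partial_gamma a (zhang_hamiltonian sigma f) p = gamma t 0 a,
      forall a, - partial_q a (zhang_hamiltonian sigma f) p
          - gamma t 0 a * partial_q0 (zhang_hamiltonian sigma f) p =
        (- ((sigma ^+ 2 * t `^ (sigma - 2)) *: gradient f (q t))
          - ((2 * sigma + 1) / t) *: gamma t) 0 a &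
      - zhang_hamiltonian sigma f p
        + \sum_(b < d) gamma t 0 b * partial_gamma b (zhang_hamiltonian sigma f) p =
      (2^-1 * (\sum_(a < d) gamma t 0 a * gamma t 0 a)
            - sigma ^+ 2 * t `^ (sigma - 2) * f (q t))
           - (2 * sigma + 1) / t * q0 t].
  split=> sol t Jt; have [eqg eqq eq0] := eqs t Jt; have [h1 h2 h3] := sol t Jt.
  - split; last by rewrite -eq0.
    + by apply/is_derive_mxP => i a; rewrite !ord1 -eqg.
    + by apply/is_derive_mxP => i a; rewrite !ord1 -eqq.
  - split; last by rewrite eq0.
    + by move=> a; rewrite eqg; exact: ((is_derive_mxP _ _ _ _ _).1 h1).
    + by move=> a; rewrite eqq; exact: ((is_derive_mxP _ _ _ _ _).1 h2).
move=> Jt p; have t0 : 0 < t := J0 _ Jt.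
have [pg pq p0] := partial_zhang_hamiltonian R d sigma f p (df _) t0.
split=> [//|a|].
- by rewrite pq p0 !mxE [gamma t 0 a * _]mulrC.
(* The sum becomes |gamma|^2, which turns the -|gamma|^2/2 of -K into +|gamma|^2/2. *)
- under eq_bigr do rewrite pg.
  by rewrite /zhang_hamiltonian/= powR_inv1 ?(ltW t0)//; field; rewrite gt_eqF.
Qed.

Theorem proposition2p2 (R : realType) (d : nat) (sigma : R)
    (f : 'rV[R]_d -> R) :
  (1 <= d)%N -> 2 <= sigma -> smooth_on setT f ->
  exists K : extended_phase R d -> R,
    smooth_on (positive_time R d) K /\
    forall J : set R, open J -> is_interval J -> J `<=` [set t | 0 < t] ->
    forall x : R -> 'rV[R]_d,
      zhang_solution sigma f J x <->
      exists (q0 : R -> R) (gamma : R -> 'rV[R]_d),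
        contact_solution K J q0 x gamma.
Proof.
move=> _ _ sf; exists (zhang_hamiltonian sigma f).
split; first exact: smooth_zhang_hamiltonian.
move=> J oJ iJ J0 x.
have df y : differentiable f y by exact: (sf 1%N).1.
split=> [zx|[q0 [gamma /(contact_zhang_hamiltonianP _ _ _ _ _ _ _ _ df J0) sol]]].
(* The equation for q forces the momentum to be the velocity; it remains to find the action along
   the curve. *)
- pose gamma := derive1 x.
  have dx t : J t -> derivable x t 1 by move=> /zx[dxt _ _]; exact: dxt.
  have dgamma t : J t -> derivable gamma t 1 by move=> /zx[_ dxt _]; exact: dxt.
  have cvx t : J t -> x @ t --> x t.
    move=> Jt; apply: differentiable_continuous.
    exact: (derivable1_diffP _ _).1 (dx t Jt).
  have cvgamma t : J t -> gamma @ t --> gamma t.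
    move=> Jt; apply: differentiable_continuous.
    exact: (derivable1_diffP _ _).1 (dgamma t Jt).
  (* The source term is the right-hand side of the action equation along the curve, continuous on
     [J] because x and gamma are differentiable there. *)
  have [] := @linear_ode_solution R J (2 * sigma + 1)
    (fun t => 2^-1 * (\sum_(a < d) gamma t 0 a * gamma t 0 a)
            - sigma ^+ 2 * t `^ (sigma - 2) * f (x t)) oJ iJ J0.
    move=> t Jt.
    have cvcoord a : gamma s 0 a @[s --> t] --> gamma t 0 a.
      exact: (cvg_comp gamma (fun M : 'rV[R]_d => M 0 a) (cvgamma t Jt)
        (@coord_continuous R 1 d 0 a (gamma t))).
    have cvpow : s `^ (sigma - 2) @[s --> t] --> t `^ (sigma - 2).
      have dpow := @is_derive1_powR R (sigma - 2) t (J0 t Jt).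
      apply: (differentiable_continuous (f := fun s : R => s `^ (sigma - 2))).
      exact: (derivable1_diffP _ _).1 (@ex_derive _ _ _ _ _ _ _ dpow).
    have cvf : f (x s) @[s --> t] --> f (x t).
      exact: (cvg_comp x f (cvx t Jt) (differentiable_continuous (df (x t)))).
    apply: cvgB.
      apply: cvgM; first exact: cvg_cst.
      by apply: cvg_big => [|a _]; [exact: add_continuous|exact: cvgM].
    by apply: cvgM => //; apply: cvgM => //; exact: cvg_cst.
  move=> q0 dq0; exists q0, gamma.
  apply/(contact_zhang_hamiltonianP _ _ _ _ _ _ _ _ df J0) => t Jt.
  split; [|apply: DeriveDef; first exact: dgamma|exact: dq0].
    by apply: DeriveDef; [exact: dx|rewrite -derive1E].
  (* Zhang's equation solved for the second derivative is the momentum equation. *)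
  have [_ _ /eqP] := zx t Jt.
  rewrite -addrA addr_eq0 => /eqP; rewrite derive1E => ->.
  by rewrite opprD addrC.
- have xE t : J t -> derive1 x t = gamma t.
    by move=> /sol[dx _ _]; rewrite derive1E; exact: derive_val.
  move=> t Jt; have [dx dg _] := sol t Jt.
  (* The velocity equals gamma only on [J]; openness of [J] makes them agree near t, so the
     derivative of gamma at t is the second derivative of x. *)
  have near_xE : \forall s \near t, gamma s = derive1 x s.
    apply: filterS (open_nbhs_nbhs (conj oJ Jt)) => s Js; exact/esym/xE.
  have d2x := near_eq_is_derive near_xE dg.
  split; [exact: ex_derive|exact: ex_derive|].
  rewrite derive1E (@derive_val _ _ _ _ _ _ _ d2x) xE//.
  by rewrite subrK addNr.
Qed.
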